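(* Let $N\ge n\ge 1$ be integers, let $\boldsymbol{x} = (x_1,\ldots,x_N)$ be variables, and let $\lambda = (\lambda_1,\ldots,\lambda_n)$ and $\rho = (\rho_1,\ldots,\rho_n)$ be partitions such that $\lambda$ is obtained from $\rho$ by removing a single box, i.e. there is an $r$ with $\lambda_i = \rho_i$ for $i \neq r$ and $\lambda_r = \rho_r - 1$. Then for positive values of the $x_i$, $s_\lambda(\boldsymbol{x})/s_\rho(\boldsymbol{x})$ is strictly decreasing in each variable. More strongly, for each $j$, the partial derivative \[ \frac{\partial}{\partial x_j}\left(\frac{s_\lambda(\boldsymbol{x})}{s_\rho(\boldsymbol{x})}\right) \] can be expressed as a ratio of polynomials where the coefficients of the denominator are nonnegative and the coefficients of the numerator are nonpositive.
   Context: A partition is a weakly decreasing sequence of nonnegative integers (zero entries allowed). $s_\rho(\boldsymbol{x})$ denotes the Schur polynomial in $x_1,\ldots,x_N$: the sum of $\boldsymbol{x}^T=\prod_{\text{boxes}} x_{T_{i,j}}$ over all semistandard Young tableaux $T$ of shape $\rho$ with entries in $\{1,\ldots,N\}$ (rows weakly increasing, columns strictly increasing). *)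

(* Defs.v *)
From mathcomp Require Import all_boot all_order all_algebra.
From mathcomp Require Import mpoly.

Set Implicit Arguments.
Unset Strict Implicit.
Unset Printing Implicit Defensive.

Import GRing.Theory.

Local Open Scope ring_scope.

(* A partition with n parts (zero parts allowed) is a function 'I_n -> nat. *)
Definition is_partition (n : nat) (rho : 'I_n -> nat) : Prop :=
  forall i j : 'I_n, (i <= j)%N -> (rho j <= rho i)%N.

Definition removes_one_box (n : nat) (lam rho : 'I_n -> nat) : Prop :=
  exists r : 'I_n,
    (lam r).+1 = rho r /\ forall i : 'I_n, i != r -> lam i = rho i.

(* The box in row i and column c of the Young diagram is Tagged _ c with
   c : 'I_(rho i); rows and columns are numbered from 0. *)
Definition box (n : nat) (rho : 'I_n -> nat) : finType :=
  {i : 'I_n & 'I_(rho i)}.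

Definition box_row (n : nat) (rho : 'I_n -> nat) (b : box rho) : nat := tag b.
Definition box_col (n : nat) (rho : 'I_n -> nat) (b : box rho) : nat :=
  tagged b.

(* The entries 1, ..., N are encoded as the elements 0, ..., N - 1 of 'I_N. *)
Definition semistandard (N n : nat) (rho : 'I_n -> nat)
    (T : {ffun box rho -> 'I_N}) : bool :=
  [forall b : box rho, forall b' : box rho,
     ((box_row b == box_row b') && (box_col b < box_col b')%N
        ==> (T b <= T b')%N)
     && ((box_col b == box_col b') && (box_row b < box_row b')%N
        ==> (T b < T b')%N)].

Definition schur (R : comNzRingType) (N n : nat) (rho : 'I_n -> nat) :
    {mpoly R[N]} :=
  \sum_(T : {ffun box rho -> 'I_N} | semistandard T) \prod_(b : box rho) 'X_(T b).

(* The value at the point x of the ratio s_lam / s_rho; it is meaningful only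
   where s_rho does not vanish (in MathComp, a / 0 = 0). *)
Definition schur_ratio (R : fieldType) (N n : nat) (lam rho : 'I_n -> nat)
    (x : 'I_N -> R) : R :=
  (schur R N lam).@[x] / (schur R N rho).@[x].

Definition set_coord (R : Type) (N : nat) (x : 'I_N -> R) (j : 'I_N) (t : R) :
    'I_N -> R :=
  fun i => if i == j then t else x i.

(* Main.v *)
(* Write P = (d_j s_lam) s_rho - s_lam (d_j s_rho), so that d_j (s_lam / s_rho)
   = P / s_rho^2.  Tableaux are encoded as Gelfand-Tsetlin patterns g, where
   g(k, r) is the number of entries < k in row r; reflecting one level of the
   pattern (Bender-Knuth) shows that Schur polynomials are symmetric, so x_j may
   be taken to be the variable attached to the smallest entry.

   P is then a sum over pairs (G, H) of patterns of shapes lam and rho, with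
   coefficient G(1, 0) - H(1, 0) (rows are numbered from 0, and level 1 of a
   pattern has a single nonzero entry).  Link two neighbouring positions when swapping
   G and H at only one of them could break an interlacing inequality, and let C
   be the connected component of the top position (N, r0) of the removed box.
   There G < H, and this strict inequality propagates along links, so G < H on
   all of C.  Swapping G and H off C is an involution on the pairs which keeps
   the monomial, and the coefficients of a pair and of its image add up to
   2 (G - H)(1, 0) if (1, 0) is in C and to 0 otherwise.  A pair with (1, 0) in
   C exists, whence the strict monotonicity. *)

Require Import Defs.
From mathcomp Require Import all_boot all_order all_algebra.
From mathcomp Require Import -(notations) mpoly.
From mathcomp Require Import all_fingroup all_classical all_reals all_analysis.
From mathcomp Require Import zify ring.

Set Implicit Arguments.
Unset Strict Implicit.
Unset Printing Implicit Defensive.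

Import Order.TTheory GRing.Theory Num.Theory.
Import numFieldNormedType.Exports.

Local Open Scope ring_scope.

(** * Gelfand-Tsetlin patterns and their weights *)

Section Patterns.
Variables (N n M : nat).

(** Every level has all [n] rows instead of forming a triangle: level 0 vanishes, so interlacing
    forces zeros in the rows [r >= k] of level [k]. The bound [M] makes the type finite. *)
Definition pattern := {ffun 'I_N.+1 * 'I_n -> 'I_M.+1}.

Definition pval (g : pattern) (k r : nat) : nat :=
  if insub k is Some i then if insub r is Some j then g (i, j) : nat else 0%N
  else 0%N.

Definition mkpattern (f : nat -> nat -> nat) : pattern :=
  [ffun p : 'I_N.+1 * 'I_n => inord (f p.1 p.2)].

Lemma pvalE (g : pattern) (i : 'I_N.+1) (j : 'I_n) : pval g i j = g (i, j).
Proof. by rewrite /pval !valK. Qed.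

Lemma pval_out (g : pattern) (k r : nat) : (n <= r)%N -> pval g k r = 0%N.
Proof.
move=> nr; rewrite /pval; case: insub => // i.
by rewrite insubF // ltnNge nr.
Qed.

Lemma pval_le (g : pattern) k r : (pval g k r <= M)%N.
Proof.
rewrite /pval; case: insub => // i; case: insub => // j.
by rewrite -ltnS ltn_ord.
Qed.

Lemma pval_mk f k r : (k <= N)%N -> (r < n)%N -> (f k r <= M)%N ->
  pval (mkpattern f) k r = f k r.
Proof.
move=> kN rn fM.
have := pvalE (mkpattern f) (@Ordinal N.+1 k kN) (Ordinal rn).
by move=> /= ->; rewrite ffunE inordK.
Qed.

Lemma pval_inj (g h : pattern) :
  (forall k r, (k <= N)%N -> (r < n)%N -> pval g k r = pval h k r) -> g = h.
Proof.
move=> gh; apply/ffunP => -[i j]; apply/val_inj.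
by rewrite /= -!pvalE gh // -ltnS.
Qed.

Definition gt_pattern (rho : 'I_n -> nat) (g : pattern) : bool :=
  [forall r : 'I_n, (pval g 0 r == 0%N) && (pval g N r == rho r)] &&
  [forall k : 'I_N, forall r : 'I_n,
     (pval g k r <= pval g k.+1 r)%N && (pval g k.+1 r.+1 <= pval g k r)%N].

Lemma gt_patternP (rho : 'I_n -> nat) (g : pattern) :
  reflect [/\ forall r : 'I_n, pval g 0 r = 0%N,
              forall r : 'I_n, pval g N r = rho r,
              forall k r, (k < N)%N -> (pval g k r <= pval g k.+1 r)%N
            & forall k r, (k < N)%N -> (pval g k.+1 r.+1 <= pval g k r)%N]
          (gt_pattern rho g).
Proof.
apply: (iffP andP) => [[/forallP h1 /forallP h2]|[h1 h2 h3 h4]].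
  split=> [r|r|k r kN|k r kN].
  - by have /andP[/eqP-> _] := h1 r.
  - by have /andP[_ /eqP->] := h1 r.
  - have [nr|rn] := leqP n r; first by rewrite !pval_out.
    by have /forallP/(_ (Ordinal rn))/andP[] := h2 (Ordinal kN).
  - have [nr|rn] := leqP n r; first by rewrite !pval_out // ltnW.
    by have /forallP/(_ (Ordinal rn))/andP[] := h2 (Ordinal kN).
split; first by apply/forallP => r; rewrite h1 h2 !eqxx.
by apply/forallP => k; apply/forallP => r; rewrite h3 ?h4.
Qed.

Definition level (g : pattern) (k : nat) : nat := (\sum_(r < n) pval g k r)%N.

(** The exponent of [y k] counts the entries [k] of the tableau; by [level_mono] the subtraction is
    exact on patterns of a given shape. *)
Definition gt_weight (A : comNzRingType) (y : 'I_N -> A) (g : pattern) : A :=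
  \prod_(k < N) y k ^+ (level g k.+1 - level g k).

Definition gt_sum (A : comNzRingType) (rho : 'I_n -> nat) (y : 'I_N -> A) : A :=
  \sum_(g | gt_pattern rho g) gt_weight y g.

Lemma gt_pattern_mono rho g : gt_pattern rho g ->
  forall k l r, (k <= l)%N -> (l <= N)%N -> (pval g k r <= pval g l r)%N.
Proof.
case/gt_patternP => _ _ h _ k l r; elim: l => [|l IH]; first by rewrite leqn0 => /eqP->.
rewrite leq_eqVlt => /orP[/eqP-> //|]; rewrite ltnS => kl lN.
by apply: leq_trans (h _ _ lN); apply: IH; rewrite // ltnW.
Qed.

Lemma level_mono rho g : gt_pattern rho g ->
  forall k, (k < N)%N -> (level g k <= level g k.+1)%N.
Proof.
by case/gt_patternP => _ _ h _ k kN; apply: leq_sum => r _; apply: h.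
Qed.

Lemma level0 rho g : gt_pattern rho g -> level g 0 = 0%N.
Proof. by case/gt_patternP => h _ _ _; rewrite /level big1. Qed.

End Patterns.

(** The count of a downward closed predicate is the length of the initial segment where it holds.
    Both directions between tableaux and patterns rest on this. *)
Lemma sum_initial (m c : nat) (P : pred nat) :
  (forall a b, (a <= b)%N -> (b < m)%N -> P b -> P a) -> (c < m)%N ->
  (c < \sum_(i < m) P i)%N = P c.
Proof.
elim: m => // m IH down cm; rewrite big_ord_recr /=.
case Pm: (P m).
  rewrite (eq_bigr (fun=> 1%N)); last first.
    by move=> i _; rewrite (down _ _ (ltnW (ltn_ord i)) (leqnn _) Pm).
  by rewrite sum1_card card_ord addn1 cm (down c m).
rewrite addn0; move: cm; rewrite ltnS leq_eqVlt => /orP[/eqP->|cm].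
  rewrite Pm ltnNge; apply/negbF.
  rewrite -[leqRHS]card_ord -sum1_card; apply: leq_sum => i _; exact: leq_b1.
by apply: IH => // a b ab bm; apply: down; rewrite // ltnW.
Qed.

Lemma sum_lt (m t : nat) : (\sum_(i < m) (i < t) = minn m t)%N.
Proof.
elim: m => [|m IH]; first by rewrite big_ord0 min0n.
by rewrite big_ord_recr /= IH; lia.
Qed.

(** * Tableaux as Gelfand-Tsetlin patterns *)

Section TableauPattern.
Variables (N n M : nat) (rho : 'I_n -> nat).
Hypotheses (hrho : is_partition rho) (rhoM : forall r, (rho r <= M)%N).
Local Notation tableau := {ffun box rho -> 'I_N.+1}.
Local Notation pattern := (pattern N.+1 n M).
Local Notation cell c := (Tagged (fun i => 'I_(rho i)) c).

Definition pattern_of (T : tableau) : pattern :=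
  [ffun p : 'I_N.+2 * 'I_n => inord (\sum_(c < rho p.2)
     (T (cell c) < p.1))].

Definition tableau_of (g : pattern) : tableau :=
  [ffun b : box rho => inord (\sum_(k < N.+1) (pval g k.+1 (tag b) <= tagged b))].

Lemma pval_pattern_of T k (r : 'I_n) : (k <= N.+1)%N ->
  pval (pattern_of T) k r =
  (\sum_(c < rho r) (T (cell c) < k))%N.
Proof.
move=> kN; have /= -> := pvalE (pattern_of T) (@Ordinal N.+2 k kN) r.
rewrite ffunE /= inordK // ltnS; apply: leq_trans (rhoM r).
rewrite -[leqRHS]card_ord -sum1_card; apply: leq_sum => i _; exact: leq_b1.
Qed.

Lemma semistandardP (T : tableau) :
  reflect ((forall r (c c' : 'I_(rho r)), (c < c')%N ->
     (T (cell c) <= T (cell c'))%N)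
   /\ (forall r r' (c : 'I_(rho r)) (c' : 'I_(rho r')),
       c = c' :> nat -> (r < r')%N ->
     (T (cell c) < T (cell c'))%N))
  (semistandard T).
Proof.
apply: (iffP forallP) => [H|[H1 H2] [r c]].
  split=> [r c c' cc'|r r' c c' cc' rr'].
    have /forallP/(_ (cell c'))/andP[/implyP h _] :=
      H (cell c).
    by apply: h; rewrite eqxx.
  have /forallP/(_ (cell c'))/andP[_ /implyP h] :=
    H (cell c).
  by apply: h; rewrite /box_col /box_row /= cc' eqxx.
apply/forallP => -[r' c']; apply/andP; split; apply/implyP => /andP[/eqP].
  rewrite /box_col /box_row /= => /val_inj e; move: c'; rewrite -e => c' cc'.
  exact: H1.
by rewrite /box_col /box_row /= => cc' rr'; apply: H2.
Qed.

Lemma lt_pattern_of T k r (c : 'I_(rho r)) : semistandard T -> (k <= N.+1)%N ->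
  (c < pval (pattern_of T) k r)%N = (T (cell c) < k)%N.
Proof.
move=> /semistandardP[H _] kN; rewrite pval_pattern_of //.
pose P d := if insub d is Some d' then
  (T (cell (d' : 'I_(rho r))) < k)%N else false.
have PE (d : 'I_(rho r)) : P d = (T (cell d) < k)%N.
  by rewrite /P valK.
under eq_bigr => d _ do rewrite -PE.
rewrite -PE sum_initial // => a b ab bm.
have am := leq_ltn_trans ab bm.
have /= -> := PE (Ordinal am); have /= -> := PE (Ordinal bm).
move: ab; rewrite leq_eqVlt => /orP[/eqP ab|ab].
  by have -> : Ordinal am = Ordinal bm by apply/val_inj.
by apply: leq_ltn_trans; apply: H.
Qed.

Lemma tableau_of_lt g k r (c : 'I_(rho r)) : gt_pattern rho g -> (k <= N.+1)%N ->
  (tableau_of g (cell c) < k)%N = (c < pval g k r)%N.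
Proof.
move=> gg; have mono := gt_pattern_mono gg; case/gt_patternP: (gg) => g0 gN _ _ kN.
rewrite ffunE /=; set S := bigop _ _ _.
have SE d : (d < N.+1)%N -> (d < S)%N = (pval g d.+1 r <= c)%N.
  move=> dN; rewrite /S (@sum_initial _ _ (fun k => pval g k.+1 r <= c)%N) //.
  by move=> a b ab bN; apply: leq_trans; apply: mono.
(* The last level is the whole shape and contains the box, so the count fits in ['I_N.+1] and
   [inord] keeps it. *)
have SN : (S < N.+1)%N by rewrite ltnS leqNgt SE // gN -ltnNge.
rewrite inordK //; case: k kN => [|k] kN; first by rewrite g0.
by rewrite ltnS leqNgt SE // -ltnNge.
Qed.

Lemma pattern_of_gt T : semistandard T -> gt_pattern rho (pattern_of T).
Proof.
move=> sT; have lt := fun k r c => @lt_pattern_of T k r c sT.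
have /semistandardP[H1 H2] := sT.
have ub k r : (k <= N.+1)%N -> (pval (pattern_of T) k r <=
    if insub r is Some r' then rho r' else 0)%N.
  move=> kN; case: insubP => [r' rn <-|]; last by rewrite -leqNgt => /pval_out->.
  rewrite pval_pattern_of // -[leqRHS]card_ord -sum1_card; apply: leq_sum => i _.
  exact: leq_b1.
(* Row lengths are compared through their columns: if the inequality failed, the column numbered by
   the smaller length would contradict the inclusion. [hrho] supplies the box of that column in the
   upper row. *)
have cmp a b k l (r r' : 'I_n) : (k <= N.+1)%N -> (l <= N.+1)%N ->
    a = r :> nat -> b = r' :> nat -> (r <= r')%N ->
    (forall c (c' : 'I_(rho r')) (c'' : 'I_(rho r)),
       c = c' :> nat -> c = c'' :> nat ->
       (c < pval (pattern_of T) k b)%N -> (c < pval (pattern_of T) l a)%N) ->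
    (pval (pattern_of T) k b <= pval (pattern_of T) l a)%N.
  move=> kN lN -> -> rr' H; rewrite leqNgt; apply/negP => h.
  have hc : (pval (pattern_of T) l r < rho r')%N.
    by apply: leq_trans h _; have := ub k r' kN; rewrite valK.
  have := H _ (Ordinal hc) (Ordinal (leq_trans hc (hrho rr'))) erefl erefl h.
  by rewrite ltnn.
apply/gt_patternP; split=> [r|r|k r kN|k r kN].
- by rewrite pval_pattern_of // big1.
- rewrite pval_pattern_of // (eq_bigr (fun=> 1%N)) => [|c _]; last by rewrite ltn_ord.
  by rewrite sum1_card card_ord.
- have [nr|rn] := leqP n r; first by rewrite !pval_out.
  apply: (cmp _ _ _ _ (Ordinal rn) (Ordinal rn)) => //; first exact: ltnW.
  move=> c c' _ -> _; have /= -> := lt k (Ordinal rn) c' (ltnW kN).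
  have /= -> := lt k.+1 (Ordinal rn) c' kN; exact: ltnW.
(* By column strictness, an entry at most [k] in row [r.+1] lies under an entry less than [k] in row
   [r]. *)
- have [nr|rn] := leqP n r.+1; first by rewrite pval_out.
  have rn' := ltnW rn.
  apply: (cmp _ _ _ _ (Ordinal rn') (Ordinal rn)) => //=; first exact: ltnW.
  move=> c c' c'' e e' h; rewrite e'.
  have /= -> := lt k (Ordinal rn') c'' (ltnW kN).
  have /= lt' := lt k.+1 (Ordinal rn) c' kN; rewrite e lt' ltnS in h.
  by apply: leq_trans h; apply: H2 => //=; rewrite -e -e'.
Qed.

Lemma tableau_of_ss g : gt_pattern rho g -> semistandard (tableau_of g).
Proof.
move=> gg; have lt := fun k r c => @tableau_of_lt g k r c gg.
have mono := gt_pattern_mono gg; case/gt_patternP: (gg) => g0 gN gv gd.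
(* Column strictness concerns any two rows, so the interlacing of adjacent rows is iterated. *)
have diag (r r' k : nat) : (r < r')%N -> (k < N.+1)%N -> (pval g k.+1 r' <= pval g k r)%N.
  move=> + kN; elim: r' => // r' IH; rewrite ltnS leq_eqVlt => /orP[/eqP->|/IH h].
    exact: gd.
  by apply: leq_trans h; apply: leq_trans (gd _ _ kN) (gv _ _ kN).
apply/semistandardP; split=> [r c c' cc'|r r' c c' cc' rr'].
  rewrite -ltnS lt; last exact: ltn_ord.
  have := ltnSn (tableau_of g (cell c')).
  by rewrite lt; [exact: ltn_trans|exact: ltn_ord].
have := ltnSn (tableau_of g (cell c')).
rewrite lt; last exact: ltn_ord.
rewrite lt => [h|]; last exact: ltnW (ltn_ord _).
rewrite cc'; apply: leq_trans h _.
exact/diag/ltn_ord.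
Qed.

Lemma tableau_ofK g : gt_pattern rho g -> pattern_of (tableau_of g) = g.
Proof.
move=> gg; have mono := gt_pattern_mono gg; case/gt_patternP: (gg) => _ gN _ _.
apply: pval_inj => k r kN rn;
have /= -> := @pval_pattern_of (tableau_of g) k (Ordinal rn) kN.
under eq_bigr => c _ do rewrite tableau_of_lt //.
by rewrite sum_lt; apply/minn_idPr; rewrite -gN; apply: mono.
Qed.

Lemma pattern_ofK T : semistandard T -> tableau_of (pattern_of T) = T.
Proof.
move=> sT; apply/ffunP => -[r c]; apply/val_inj/eqP => /=.
have E k : (k <= N.+1)%N -> (tableau_of (pattern_of T) (cell c) < k)%N
   = (T (cell c) < k)%N.
  by move=> kN; rewrite tableau_of_lt ?lt_pattern_of // pattern_of_gt.
rewrite eqn_leq -ltnS E ?ltn_ord // ltnSn /=.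
by rewrite -ltnS -E ?ltn_ord // ltnSn.
Qed.

Lemma level_pattern_of T k : (k <= N.+1)%N ->
  level (pattern_of T) k = (\sum_(b : box rho) (T b < k))%N.
Proof.
move=> kN; rewrite /level.
rewrite (eq_bigr _ (fun r _ => pval_pattern_of T r kN)).
by rewrite sig_big_dep /=; apply: eq_bigr => -[].
Qed.

Lemma gt_weight_pattern_of (A : comNzRingType) (y : 'I_N.+1 -> A) T :
  gt_weight y (pattern_of T) = \prod_(b : box rho) y (T b).
Proof.
rewrite (partition_big T predT) //=; apply: eq_bigr => k _.
rewrite (eq_bigr (fun=> y k)) => [|b /eqP-> //]; rewrite prodr_const.
congr (_ ^+ _); rewrite !level_pattern_of ?ltn_ord 1?ltnW //.
rewrite -sum1_card [RHS]big_mkcond /= -sumnB => [|b _]; last by case: ltngtP => //; lia.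
apply: eq_bigr => b _; rewrite unfold_in /= -[eqn _ _]/(T b == k :> nat).
by rewrite ltnS; case: ltngtP.
Qed.

Lemma gt_sum_tableau (A : comNzRingType) (y : 'I_N.+1 -> A) :
  \sum_(T : tableau | semistandard T) \prod_(b : box rho) y (T b) =
  gt_sum M rho y.
Proof.
rewrite (reindex_onto tableau_of pattern_of) => [|T]; last exact: pattern_ofK.
apply: eq_big => [g|g].
  apply/andP/idP => [[h /eqP<-]|h]; first exact: pattern_of_gt.
  by rewrite tableau_of_ss // tableau_ofK.
by case/andP=> h /eqP e; rewrite -gt_weight_pattern_of e.
Qed.

End TableauPattern.

(** * Symmetry *)

(** Termwise [maxn (a r) (b r.+1) + hi r.+1 = a r + b r.+1]; the shift by one leaves [hi 0 = b 0]
    and [hi n] at the ends. *)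
Lemma sum_max_min (n : nat) (a b : nat -> nat) :
  let hi r := if r is r'.+1 then minn (a r') (b r) else b 0 in
  (\sum_(r < n) (maxn (a r) (b r.+1) + hi r) + hi n =
   \sum_(r < n) a r + \sum_(r < n.+1) b r)%N.
Proof.
move=> hi; elim: n => [|n IH]; first by rewrite !big_ord0 big_ord1.
rewrite big_ord_recr [X in (_ = X + _)%N]big_ord_recr [X in (_ = _ + X)%N]big_ord_recr.
by move: IH => /=; lia.
Qed.

Section BenderKnuth.
Variables (N n M : nat) (rho : 'I_n -> nat) (k : nat).
Hypothesis kN : (k.+1 < N)%N.
Local Notation pattern := (pattern N n M).

(* Given the levels [k] and [k.+2], the interlacing conditions let entry [r] of
   level [k.+1] range exactly over the interval from [bk_lo g r] to [bk_hi g r];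
   the involution reflects it there. *)
Definition bk_lo (g : pattern) (r : nat) : nat :=
  maxn (pval g k r) (pval g k.+2 r.+1).

Definition bk_hi (g : pattern) (r : nat) : nat :=
  if r is r'.+1 then minn (pval g k r') (pval g k.+2 r) else pval g k.+2 0.

Definition bk_fun (g : pattern) (l r : nat) : nat :=
  if l == k.+1 then (bk_lo g r + bk_hi g r - pval g k.+1 r)%N else pval g l r.

Definition bk (g : pattern) : pattern := mkpattern N n M (bk_fun g).

Lemma bk_bounds g r : gt_pattern rho g ->
  (bk_lo g r <= pval g k.+1 r)%N && (pval g k.+1 r <= bk_hi g r)%N.
Proof.
case/gt_patternP => _ _ gv gd; have := gv k.+1 r kN; have := gd k.+1 r kN.
have := gv k r (ltnW kN); case: r => [|r]; rewrite /bk_lo /bk_hi; first by lia.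
by have := gd k r (ltnW kN); lia.
Qed.

Lemma bk_hi_le g r : (bk_hi g r <= pval g k.+2 r)%N.
Proof. by case: r => //= r; rewrite geq_minr. Qed.

Lemma pval_bk g l r : gt_pattern rho g -> (l <= N)%N ->
  pval (bk g) l r = bk_fun g l r.
Proof.
move=> gg lN; have [nr|rn] := leqP n r.
  rewrite pval_out // /bk_fun; case: ifP => _; last by rewrite pval_out.
  by have := bk_hi_le g r; rewrite /bk_lo !(pval_out _ _ nr) pval_out ?leqW //; lia.
rewrite pval_mk // /bk_fun; case: ifP => _; last exact: pval_le.
have := bk_bounds r gg; have := bk_hi_le g r; have := pval_le g k.+2 r; lia.
Qed.

Lemma bk_gt g : gt_pattern rho g -> gt_pattern rho (bk g).
Proof.
move=> gg; case/gt_patternP: (gg) => g0 gN gv gd; have pE l r := @pval_bk g l r gg.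
apply/gt_patternP; split=> [r|r|l r lN|l r lN].
- by rewrite pE // /bk_fun g0.
- by rewrite pE // /bk_fun gtn_eqF ?gN.
- rewrite !pE ?(ltnW lN) // /bk_fun eqSS.
  have b := bk_bounds r gg; have h := bk_hi_le g r.
  have [->|lk] := eqVneq l k.+1.
    by rewrite gtn_eqF //; lia.
  have [->|lk'] := eqVneq l k; last exact: gv.
  by rewrite /bk_lo in b *; lia.
- rewrite !pE ?(ltnW lN) // /bk_fun eqSS.
  have [->|lk] := eqVneq l k.+1.
    by rewrite gtn_eqF //; have := bk_bounds r gg; rewrite /bk_lo; lia.
  have [->|lk'] := eqVneq l k; last exact: gd.
  by have := bk_bounds r.+1 gg; rewrite /bk_hi; lia.
Qed.

(** The bounds depend only on levels [k] and [k.+2], which [bk] leaves alone, so the same intervals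
    are reflected twice. *)
Lemma bkK g : gt_pattern rho g -> bk (bk g) = g.
Proof.
move=> gg; apply: pval_inj => l r lN rn; rewrite (pval_bk _ (bk_gt gg)) //.
have E r' : (bk_lo (bk g) r' = bk_lo g r') * (bk_hi (bk g) r' = bk_hi g r').
  have pE m r'' : (m <= N)%N -> m != k.+1 -> pval (bk g) m r'' = pval g m r''.
    by move=> mN mk; rewrite (pval_bk _ gg) // /bk_fun (negbTE mk).
  have kN' : (k <= N)%N by lia.
  have nk : k != k.+1 by lia.
  have nk' : k.+2 != k.+1 by lia.
  by split; case: r' => [|r']; rewrite /bk_lo /bk_hi !pE.
rewrite {1}/bk_fun !E !(pval_bk _ gg) ?(ltnW kN) // /bk_fun eqxx.
by case: eqP => [->|//]; have := bk_bounds r gg; lia.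
Qed.

Lemma level_bk g l : gt_pattern rho g -> (l <= N)%N ->
  level (bk g) l =
  if l == k.+1 then (level g k + level g k.+2 - level g k.+1)%N else level g l.
Proof.
move=> gg lN; rewrite /level (eq_bigr _ (fun (r : 'I_n) _ => pval_bk r gg lN)) /bk_fun.
case: ifP => // _; rewrite sumnB; last first.
  by move=> r _; have := bk_bounds r gg; lia.
congr subn; have := sum_max_min n (pval g k) (pval g k.+2).
rewrite big_ord_recr /= (pval_out g k.+2 (leqnn n)) addn0 => <-.
(* The boundary term vanishes because row [n] of level [k.+2] reads as 0. *)
rewrite [X in (_ = _ + X)%N](_ : _ = 0)%N ?addn0 //.
move: (pval g k) (pval g k.+2) (pval_out g k.+2 (leqnn n)) => a b.
by case: n => [|n'] // ->; rewrite minn0.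
Qed.

(** The reflection exchanges the increments of the level totals at [k] and [k.+1]. *)
Lemma gt_weight_bk (A : comNzRingType) (y : 'I_N -> A) g : gt_pattern rho g ->
  gt_weight y (bk g) =
  gt_weight (y \o tperm (Ordinal (ltnW kN)) (Ordinal kN)) g.
Proof.
move=> gg; rewrite /gt_weight.
pose t := tperm (Ordinal (ltnW kN)) (Ordinal kN).
rewrite [RHS](reindex_inj (@perm_inj _ t)) /=.
apply: eq_bigr => l _; rewrite tpermK; congr (_ ^+ _).
have m1 := level_mono gg (ltnW kN); have m2 := level_mono gg kN.
rewrite !level_bk ?(ltnW (ltn_ord l)) // eqSS.
case: tpermP => [->|->|/eqP lk /eqP lk'] /=; rewrite ?eqxx.
- by rewrite (ltn_eqF (ltnSn k)); lia.
- by rewrite (gtn_eqF (ltnSn k)); lia.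
- by rewrite (negbTE (lk : l != k :> nat)) (negbTE (lk' : l != k.+1 :> nat)).
Qed.

Lemma gt_sum_tperm (A : comNzRingType) (y : 'I_N -> A) :
  gt_sum M rho (y \o tperm (Ordinal (ltnW kN)) (Ordinal kN)) = gt_sum M rho y.
Proof.
rewrite [RHS](reindex_onto bk bk) => [|g]; last exact: bkK.
apply: eq_big => [g|g gg]; last by rewrite gt_weight_bk.
apply/idP/andP => [gg|[gg /eqP e]]; first by rewrite bk_gt // bkK.
by rewrite -e bk_gt.
Qed.

End BenderKnuth.

(** Adjacent transpositions are composed. The permutation is chosen before the shape, so that one
    choice serves both Schur polynomials. *)
Lemma gt_sum_front (N n M : nat) (j : 'I_N.+1) : exists s : 'S_N.+1,
  s ord0 = j /\ forall (A : comNzRingType) (rho : 'I_n -> nat) (y : 'I_N.+1 -> A),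
    gt_sum M rho (y \o s) = gt_sum M rho y.
Proof.
case: j => j; elim: j => [|j IH] jN.
  exists 1%g; split=> [|A rho y]; first by apply/val_inj; rewrite perm1.
  by congr gt_sum; apply/funext => i /=; rewrite perm1.
have [s [s0 sE]] := IH (ltnW jN).
exists (s * tperm (Ordinal (ltnW jN)) (Ordinal jN))%g; split.
  by rewrite permM s0 tpermL.
move=> A rho y; rewrite -(gt_sum_tperm M rho jN y) -[RHS]sE.
by congr gt_sum; apply/funext => i /=; rewrite permM.
Qed.

(** * The flip of a pair of patterns *)

Section Flip.
Variables (N n M : nat) (lam rho : 'I_n -> nat) (r0 : 'I_n).
Local Notation pattern := (pattern N n M).
Local Notation node := ('I_N.+1 * 'I_n)%type.

(** The edges of the interlacing order: the value at [p] must be at most the value at [q]. *)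
Definition covers (p q : node) : bool :=
  ((q.1 == p.1.+1 :> nat) && (p.2 == q.2)) ||
  ((p.1 == q.1.+1 :> nat) && (p.2 == q.2.+1 :> nat)).

Lemma gt_pattern_covers (mu : 'I_n -> nat) (g : pattern) :
  gt_pattern mu g <->
  [/\ forall r, g (ord0, r) = 0%N :> nat, forall r, g (ord_max, r) = mu r :> nat
    & forall p q, covers p q -> (g p <= g q)%N].
Proof.
split=> [/gt_patternP[g0 gN gv gd]|[g0 gN gc]].
  split=> [r|r|[k r] [l r']]; rewrite -?pvalE ?g0 ?gN // /covers /=.
  move=> /orP[/andP[/eqP kl /eqP->]|/andP[/eqP kl /eqP rr]].
    by rewrite kl; apply: gv; rewrite -ltnS -kl.
  by rewrite kl rr; apply: gd; rewrite -ltnS -kl.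
apply/gt_patternP; split=> [r|r|k r kN|k r kN].
- by rewrite -[RHS](g0 r) -pvalE.
- by rewrite -[RHS](gN r) -pvalE.
- have [nr|rn] := leqP n r; first by rewrite !pval_out.
  have := gc (Ordinal (ltnW kN : (k < N.+1)%N), Ordinal rn)
             (Ordinal (kN : (k.+1 < N.+1)%N), Ordinal rn).
  by rewrite -!pvalE /=; apply; rewrite /covers /= !eqxx.
- have [nr|rn] := leqP n r.+1; first by rewrite pval_out.
  have := gc (Ordinal (kN : (k.+1 < N.+1)%N), Ordinal rn)
             (Ordinal (ltnW kN : (k < N.+1)%N), Ordinal (ltnW rn)).
  by rewrite -!pvalE /=; apply; rewrite /covers /= !eqxx orbT.
Qed.

(* Linked nodes are those where exchanging the values of [G] and [H] at only one
   of the two breaks the inequality between them. *)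
Definition link (G H : pattern) (p q : node) : bool :=
  (covers p q && (minn (G q) (H q) < maxn (G p) (H p))%N) ||
  (covers q p && (minn (G p) (H p) < maxn (G q) (H q))%N).

Definition component (G H : pattern) : pred node := connect (link G H) (ord_max, r0).

(** The involution is [(G, H) -> (flip G H, flip H G)]; one definition gives both halves because
    [component] is symmetric in its two patterns. *)
Definition flip (G H : pattern) : pattern :=
  [ffun p => if component G H p then G p else H p].

(** Links see only the unordered pair of values at each node, so swapping values preserves the
    component; hence the flip is involutive. *)
Lemma eq_component (G H G' H' : pattern) :
  (forall p, minn (G p) (H p) = minn (G' p) (H' p)) ->
  (forall p, maxn (G p) (H p) = maxn (G' p) (H' p)) -> component G H =1 component G' H'.
Proof.
move=> emin emax p; apply: eq_connect => {}p q.
by rewrite /link !emin !emax.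
Qed.

Lemma componentC G H : component H G =1 component G H.
Proof. by apply: eq_component => p; rewrite (minnC, maxnC). Qed.

Lemma flip_swapE G H p : flip H G p = if component G H p then H p else G p.
Proof. by rewrite ffunE componentC. Qed.

Lemma component_flip G H : component (flip G H) (flip H G) =1 component G H.
Proof.
by apply: eq_component => p; rewrite (flip_swapE G H) ffunE; case: ifP => // _;
  rewrite (minnC, maxnC).
Qed.

Lemma flipK G H : flip (flip G H) (flip H G) = G.
Proof.
apply/ffunP => p; rewrite [LHS]ffunE component_flip !ffunE (componentC G H).
by case: (component G H p).
Qed.

Lemma component_top G H : component G H (ord_max, r0).
Proof. exact: connect0. Qed.

Lemma component_link G H p q : component G H p -> link G H p q -> component G H q.
Proof. by move=> cp /connect1; apply: connect_trans. Qed.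

Lemma linkC G H p q : link G H p q = link G H q p.
Proof. by rewrite /link orbC. Qed.

(** An edge on one side of the component's boundary inherits its inequality from [G] or [H]. An edge
    across the boundary is not a link, so both values at [p] are at most both values at [q]. *)
Lemma flip_covers (G H : pattern) p q :
  (G p <= G q)%N -> (H p <= H q)%N -> covers p q -> (flip G H p <= flip G H q)%N.
Proof.
move=> Gpq Hpq cpq; rewrite !ffunE.
case: ifP => cp; case: ifP => cq //.
  have : ~~ link G H p q by apply/negP => /(component_link cp); rewrite cq.
  by rewrite /link cpq /= negb_or => /andP[+ _]; lia.
have : ~~ link G H p q by rewrite linkC; apply/negP => /(component_link cq); rewrite cp.
by rewrite /link cpq /= negb_or => /andP[+ _]; lia.
Qed.

Lemma level_flipD G H k : (k <= N)%N ->
  (level (flip G H) k + level (flip H G) k = level G k + level H k)%N.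
Proof.
move=> kN; rewrite /level -!big_split; apply: eq_bigr => r _ /=.
have pE g : pval g k r = g (@Ordinal N.+1 k kN, r) by rewrite -pvalE.
by rewrite !pE (flip_swapE G H) ffunE; case: ifP; lia.
Qed.

Definition part_at (mu : 'I_n -> nat) (r : nat) : nat :=
  if insub r is Some i then mu i else 0%N.

(* The pattern is constantly [mu r0] on the path of nodes
   [(N, r0), ..., (r0 + 1, r0), (r0, r0 - 1), ..., (1, 0)]; this links the path
   for the two patterns of shapes [lam] and [rho], which differ by one there. *)
Definition hook_pattern (mu : 'I_n -> nat) : pattern :=
  mkpattern N n M (fun k r => if (r < k)%N then
    part_at mu (r + (r0.+1 - k)) else 0%N).

Lemma pval_hook (mu : 'I_n -> nat) k r : (forall i, (mu i <= M)%N) -> (k <= N)%N ->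
  pval (hook_pattern mu) k r = if (r < k)%N then
    part_at mu (r + (r0.+1 - k)) else 0%N.
Proof.
move=> muM kN; have [nr|rn] := leqP n r.
  rewrite pval_out //; case: ifP => // _; rewrite /part_at insubF //; lia.
by rewrite pval_mk //; case: ifP => // _; rewrite /part_at; case: insub.
Qed.

(** From level [k] to [k.+1] the shift [r0.+1 - k] drops by at most one, and parts decrease with
    their index; this gives both interlacing inequalities. Since [n <= N], the top level is complete
    and unshifted. *)
Lemma hook_gt (mu : 'I_n -> nat) : (n <= N)%N -> is_partition mu ->
  (forall i, (mu i <= M)%N) -> gt_pattern mu (hook_pattern mu).
Proof.
move=> nN muP muM.
have mono a b : (a <= b)%N -> (part_at mu b <= part_at mu a)%N.
  move=> ab; rewrite /part_at; case: (insubP _ b) => // i bn ib.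
  have an : (a < n)%N by apply: leq_ltn_trans bn.
  by rewrite (insubT (fun m => (m < n)%N) an) muP // ib.
apply/gt_patternP; split=> [r|r|k r kN|k r kN].
- by rewrite pval_hook.
- rewrite pval_hook // (leq_trans (ltn_ord r) nN).
  by rewrite (_ : r0.+1 - N = 0)%N ?addn0 /part_at ?valK //; have := ltn_ord r0; lia.
- rewrite !pval_hook ?(ltnW kN) //; case: ifP => // rk; rewrite ltnS (ltnW rk).
  by apply: mono; lia.
- rewrite !pval_hook ?(ltnW kN) // ltnS; case: ifP => // rk.
  by apply: mono; lia.
Qed.

Hypothesis lam_rho : forall i : 'I_n, i != r0 -> lam i = rho i.

(** At the top level the shapes differ only at [r0], and that node is in the component, so it is
    never swapped. *)
Lemma flip_gt_lam G H : gt_pattern lam G -> gt_pattern rho H ->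
  gt_pattern lam (flip G H).
Proof.
move=> /gt_pattern_covers[G0 GN Gc] /gt_pattern_covers[H0 HN Hc].
apply/gt_pattern_covers; split=> [r|r|p q cpq].
- by rewrite ffunE; case: ifP.
- rewrite ffunE; case: ifP => // /negP nc; rewrite HN lam_rho //.
  by apply/eqP => e; apply: nc; rewrite e component_top.
- exact: flip_covers (Gc _ _ cpq) (Hc _ _ cpq) cpq.
Qed.

Lemma flip_gt_rho G H : gt_pattern lam G -> gt_pattern rho H ->
  gt_pattern rho (flip H G).
Proof.
move=> /gt_pattern_covers[G0 GN Gc] /gt_pattern_covers[H0 HN Hc].
apply/gt_pattern_covers; split=> [r|r|p q cpq].
- by rewrite flip_swapE; case: ifP.
- rewrite flip_swapE; case: ifP => // /negP nc; rewrite GN lam_rho //.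
  by apply/eqP => e; apply: nc; rewrite e component_top.
- exact: flip_covers (Hc _ _ cpq) (Gc _ _ cpq) cpq.
Qed.

Hypothesis lamr0 : (lam r0).+1 = rho r0.

(** Induction along a path of links. If [covers p q] and [G p < H p], the link gives
    [minn (G q) (H q) < H p <= H q], so the minimum is [G q]; the other orientation is dual. *)
Lemma component_lt (G H : pattern) p :
  gt_pattern lam G -> gt_pattern rho H -> component G H p -> (G p < H p)%N.
Proof.
move=> /gt_pattern_covers[_ GN Gc] /gt_pattern_covers[_ HN Hc] /connectP[s + ->].
have : (G (ord_max, r0) < H (ord_max, r0))%N by rewrite GN HN -lamr0.
elim: s (ord_max, r0) => //= q s IH x xlt /andP[xq]; apply: IH.
by case/orP: xq => /andP[cxq]; have := Gc _ _ cxq; have := Hc _ _ cxq; lia.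
Qed.

(** Node by node, the two sides are [2 G] and [2 H] on the component, and both are [G + H]
    elsewhere. *)
Lemma level_flip_le G H k : gt_pattern lam G -> gt_pattern rho H -> (k <= N)%N ->
  (level G k + level (flip G H) k <= level H k + level (flip H G) k)%N.
Proof.
move=> gG gH kN; rewrite /level -!big_split; apply: leq_sum => r _ /=.
have pE g : pval g k r = g (@Ordinal N.+1 k kN, r) by rewrite -pvalE.
rewrite !pE (flip_swapE G H) ffunE; case: ifP => [c|_]; last by lia.
by have := component_lt gG gH c; lia.
Qed.

Lemma level_flip_lt G H (k : 'I_N.+1) r : gt_pattern lam G -> gt_pattern rho H ->
  component G H (k, r) ->
  (level G k + level (flip G H) k < level H k + level (flip H G) k)%N.
Proof.
move=> gG gH ckr; have lt := component_lt gG gH ckr.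
rewrite /level -!big_split /= !(bigD1 r (P := xpredT)) //= !pvalE.
rewrite (flip_swapE G H) ffunE ckr -addSn leq_add //; first by lia.
apply: leq_sum => r' _ /=; rewrite !pvalE (flip_swapE G H) ffunE.
case: ifP => [c|_]; last by lia.
by have := component_lt gG gH c; lia.
Qed.

Lemma component_hook : (n <= N)%N ->
  (forall i, (lam i <= M)%N) -> (forall i, (rho i <= M)%N) ->
  forall r : 'I_n, r = 0%N :> nat ->
  component (hook_pattern lam) (hook_pattern rho) (inord 1, r).
Proof.
move=> nN lamM rhoM r r_0; have r0N := leq_trans (ltn_ord r0) nN.
set G := hook_pattern lam; set H := hook_pattern rho.
have val (k : 'I_N.+1) (i : 'I_n) : (i < k)%N -> (i + (r0.+1 - k) = r0)%N ->
    G (k, i) = lam r0 :> nat /\ H (k, i) = rho r0 :> nat.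
  move=> ik e; rewrite -!pvalE !pval_hook //; try by rewrite -ltnS.
  by rewrite ik e /part_at !valK.
have step p q : covers p q || covers q p -> (p.2 < p.1)%N -> (q.2 < q.1)%N ->
    (p.2 + (r0.+1 - p.1) = r0)%N -> (q.2 + (r0.+1 - q.1) = r0)%N -> link G H p q.
  case: p q => [k i] [l j] /= c ik jl ei ej.
  have [Gp Hp] := val k i ik ei; have [Gq Hq] := val l j jl ej.
  by move: c; rewrite /link Gp Hp Gq Hq -lamr0 => /orP[] ->; rewrite ?orbT /=; lia.
(* The path goes down row [r0] to level [r0.+1], then along the diagonal to [(1, 0)]. *)
have vert d : (d <= N - r0.+1)%N -> component G H (inord (N - d), r0).
  elim: d => [|d IH] dN.
    rewrite subn0 (_ : inord N = ord_max) ?component_top //.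
    by apply/val_inj; rewrite /= inordK.
  apply: component_link (IH (ltnW dN)) _.
  by apply: step => /=; rewrite /covers /= ?eqxx ?andbT ?inordK; lia.
have diag d (i : 'I_n) : (i + d = r0)%N -> component G H (inord i.+1, i).
  elim: d i => [|d IH] i id.
    rewrite (_ : i = r0); last by apply/val_inj; rewrite -[LHS]addn0.
    by have := vert _ (leqnn _); rewrite subKn.
  have i1n : (i.+1 < n)%N by have := ltn_ord r0; lia.
  apply: component_link (IH (Ordinal i1n) _) _ => /=; first by lia.
  by apply: step => /=; rewrite /covers /= ?eqxx ?andbT ?inordK; lia.
by have := diag r0 r; rewrite r_0; apply.
Qed.

End Flip.

(** * The numerator of the derivative *)

Section Numerator.
Variables (R : realType) (N n M : nat) (j : 'I_N.+1) (s : 'S_N.+1).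
Hypothesis s0 : s ord0 = j.
Local Notation pattern := (pattern N.+1 n M).
Local Notation XM m := (mpolyX R m).

Definition content (g : pattern) : multinom N.+1 :=
  Multinom [tuple (level g (s^-1%g i).+1 - level g (s^-1%g i))%N | i < N.+1].

Lemma gt_weightX (g : pattern) :
  gt_weight (fun k => XM (mnm1 (s k))) g = XM (content g).
Proof.
by rewrite (mpolyXE _ s); apply: eq_bigr => k _; rewrite mnmE permK.
Qed.

Lemma content_front mu (g : pattern) : gt_pattern mu g -> content g j = level g 1.
Proof. by move=> gg; rewrite mnmE -s0 permK /= (level0 gg) subn0. Qed.

(** In this form the monomial depends only on [m + m'], which the flip preserves. If the subtraction
    truncates, then [m j] is 0 and the term vanishes. *)
Lemma mderivX_mul (m m' : multinom N.+1) :
  mderiv j (XM m) * XM m' = (m j)%:R *: XM (mnm_sub (mnm_add m m') (mnm1 j)).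
Proof.
rewrite mderivX -scalerAl -mpolyXD; have [->|mj] := eqVneq (m j) 0%N.
  by rewrite !scale0r.
congr (_ *: mpolyX R _); apply/mnmP => i; rewrite !(mnmDE, mnmBE) mnm1E.
by case: eqP => [<-|_]; lia.
Qed.

Definition gt_poly (mu : 'I_n -> nat) : mpoly N.+1 R :=
  \sum_(g : pattern | gt_pattern mu g) XM (content g).

Lemma mcoeff_gt_poly_sqr mu m : 0 <= mcoeff m (gt_poly mu ^+ 2).
Proof.
rewrite expr2 big_distrlr raddf_sum sumr_ge0 //= => G _.
rewrite raddf_sum sumr_ge0 //= => H _.
by rewrite -mpolyXD mcoeffX ler0n.
Qed.

Lemma meval_X_gt0 (x : 'I_N.+1 -> R) m : (forall i, 0 < x i) -> 0 < meval x (XM m).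
Proof. by move=> x0; rewrite mevalX prodr_gt0 // => i _; rewrite exprn_gt0. Qed.

Lemma meval_gt_poly_gt0 mu (g : pattern) (x : 'I_N.+1 -> R) :
  gt_pattern mu g -> (forall i, 0 < x i) -> 0 < meval x (gt_poly mu).
Proof.
move=> gg x0; rewrite raddf_sum (bigD1 g) //= ltr_pwDl ?meval_X_gt0 //.
by rewrite sumr_ge0 // => h _; rewrite ltW // meval_X_gt0.
Qed.

Variables (lam rho : 'I_n -> nat) (r0 : 'I_n).
Hypotheses (lamr0 : (lam r0).+1 = rho r0)
           (lam_rho : forall i : 'I_n, i != r0 -> lam i = rho i).

Definition numerator : mpoly N.+1 R :=
  mderiv j (gt_poly lam) * gt_poly rho - gt_poly lam * mderiv j (gt_poly rho).

(** Minus the sum of the coefficients of a pair and of its flip; [level_flip_le] makes the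
    subtraction exact for shapes [lam] and [rho]. *)
Definition gain (p : pattern * pattern) : nat :=
  (level p.2 1 + level (flip r0 p.2 p.1) 1 -
   (level p.1 1 + level (flip r0 p.1 p.2) 1))%N.

Lemma content_flipD G H : gt_pattern lam G -> gt_pattern rho H ->
  mnm_add (content (flip r0 G H)) (content (flip r0 H G)) =
  mnm_add (content G) (content H).
Proof.
move=> gG gH; apply/mnmP => i; rewrite !mnmDE !mnmE.
set k := (s^-1)%g i; have kN := ltn_ord k.
have := level_mono gG kN; have := level_mono gH kN.
have := level_mono (flip_gt_lam lam_rho gG gH) kN.
have := level_mono (flip_gt_rho lam_rho gG gH) kN.
have := level_flipD r0 G H kN; have := level_flipD r0 G H (ltnW kN).
lia.
Qed.

(** The sum is added to its reindexing by the flip; doubling avoids choosing representatives of the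
    orbits. *)
Lemma numerator_sum : numerator *+ 2 =
  - \sum_(p : pattern * pattern | gt_pattern lam p.1 && gt_pattern rho p.2)
      (gain p)%:R *: XM (mnm_sub (mnm_add (content p.1) (content p.2)) (mnm1 j)).
Proof.
pose F (p : pattern * pattern) : mpoly N.+1 R :=
  ((level p.1 1)%:R - (level p.2 1)%:R) *:
  XM (mnm_sub (mnm_add (content p.1) (content p.2)) (mnm1 j)).
have -> : numerator = \sum_(p | gt_pattern lam p.1 && gt_pattern rho p.2) F p.
  rewrite /numerator /gt_poly !raddf_sum !big_distrlr !pair_big -sumrB /=.
  apply: eq_bigr => -[G H] /= /andP[gG gH].
  rewrite mderivX_mul [X in _ - X]mulrC mderivX_mul.
  rewrite (content_front gG) (content_front gH) /F /= scalerBl.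
  have -> // : mnm_add (content H) (content G) = mnm_add (content G) (content H).
  by apply/mnmP => i; rewrite !mnmDE addnC.
pose phi (p : pattern * pattern) := (flip r0 p.1 p.2, flip r0 p.2 p.1).
have phiK : involutive phi by move=> [G H]; rewrite /phi /= !flipK.
have phi_gt p : gt_pattern lam p.1 && gt_pattern rho p.2 ->
    gt_pattern lam (phi p).1 && gt_pattern rho (phi p).2.
  case: p => G H /andP[gG gH].
  by rewrite (flip_gt_lam lam_rho gG gH) (flip_gt_rho lam_rho gG gH).
rewrite mulr2n {2}(reindex_inj (inv_inj phiK)) /=.
rewrite [X in _ + X](eq_bigl
  (fun p => gt_pattern lam p.1 && gt_pattern rho p.2)); last first.
  move=> p; apply/idP/idP => [h|]; last exact: phi_gt.
  by have := phi_gt (phi p) h; rewrite phiK.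
rewrite -big_split -sumrN; apply: eq_bigr => -[G H] /= /andP[gG gH].
rewrite /F /= content_flipD // -scalerDl -scaleNr; congr (_ *: _).
have le := level_flip_le lamr0 gG gH (ltn0Sn N).
by rewrite /gain /= natrB // !natrD; ring.
Qed.

Lemma mcoeff_numerator_le0 m : mcoeff m numerator <= 0.
Proof.
rewrite -(pmulrn_lle0 _ (ltn0Sn 1)) -mcoeffMn numerator_sum mcoeffN oppr_le0.
rewrite raddf_sum sumr_ge0 //= => p _.
by rewrite mcoeffZ mcoeffX mulr_ge0.
Qed.

Lemma meval_numerator_lt0 (x : 'I_N.+1 -> R) :
  (n <= N.+1)%N -> is_partition lam -> is_partition rho ->
  (forall i, (lam i <= M)%N) -> (forall i, (rho i <= M)%N) ->
  (forall i, 0 < x i) -> meval x numerator < 0.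
Proof.
move=> nN hlam hrho lamM rhoM x0.
rewrite -(pmulrn_llt0 _ (ltn0Sn 1)) -mevalMn numerator_sum mevalN oppr_lt0.
(* This pair has [(1, 0)] in its component, so its gain is positive. *)
pose p := (hook_pattern N.+1 M r0 lam, hook_pattern N.+1 M r0 rho).
have plam : gt_pattern lam p.1 by apply: hook_gt.
have prho : gt_pattern rho p.2 by apply: hook_gt.
rewrite raddf_sum (bigD1 p) ?plam ?prho //= ltr_pwDl //; last first.
  by rewrite sumr_ge0 // => q _; rewrite mevalZ mulr_ge0 // ltW // meval_X_gt0.
rewrite mevalZ mulr_gt0 ?meval_X_gt0 // ltr0n subn_gt0.
have n0 : (0 < n)%N by apply: leq_ltn_trans (ltn_ord r0).
have c := @component_hook N.+1 n M lam rho r0 lamr0 nN lamM rhoM (Ordinal n0) erefl.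
by have := level_flip_lt lamr0 plam prho c; rewrite inordK.
Qed.

End Numerator.

(** Symmetry allows the variable of index [s k] to be attached to the entry [k]. *)
Lemma schur_gt_poly (R : realType) (N n M : nat) (s : 'S_N.+1) (mu : 'I_n -> nat) :
  is_partition mu -> (forall i, (mu i <= M)%N) ->
  (forall (A : comNzRingType) (rho : 'I_n -> nat) (y : 'I_N.+1 -> A),
    gt_sum M rho (y \o s) = gt_sum M rho y) ->
  schur R N.+1 mu = gt_poly R M s mu.
Proof.
move=> hmu muM sE; apply: etrans (gt_sum_tableau hmu muM (fun k => mpolyX R (mnm1 k))) _.
by rewrite -sE; apply: eq_bigr => g _; rewrite -gt_weightX.
Qed.

(** * Derivatives of evaluations *)

Section Derivative.
Variables (R : realType) (N : nat) (j : 'I_N).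

Lemma set_coord_id (x : 'I_N -> R) : set_coord x j (x j) = x.
Proof. by apply/funext => i; rewrite /set_coord; case: eqP => [->|]. Qed.

Lemma set_coord_set (x : 'I_N -> R) c t :
  set_coord (set_coord x j c) j t = set_coord x j t.
Proof. by apply/funext => i; rewrite /set_coord; case: eqP. Qed.

Lemma is_derive_meval (p : mpoly N R) (x : 'I_N -> R) :
  is_derive (x j) (1 : R) (fun t => meval (set_coord x j t) p)
    (meval x (mderiv j p)).
Proof.
elim/mpolyind: p => [|c m p _ _ IH].
  rewrite mderiv0 meval0 (_ : (fun _ => _) = cst 0); first exact: is_derive_cst.
  by apply/funext => t; rewrite meval0.
rewrite mderivD mderivZ mderivX mevalD !mevalZ mevalX.
(* The factor of the monomial's value that is constant in [t]. *)
pose C := \prod_(i < N | i != j) x i ^+ m i.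
rewrite (_ : (fun _ => _) = (c * C) \*: (id ^+ m j) +
    (fun t => meval (set_coord x j t) p)); last first.
  apply/funext => t; rewrite mevalD mevalZ mevalX (bigD1 j) //= /set_coord eqxx.
  rewrite (eq_bigr (fun i => x i ^+ m i)) -/C => [|i /negbTE -> //].
  rewrite -[RHS]/(c * C * ((id ^+ m j : R -> R) t) + _) exprfctE /=.
  by rewrite [_ ^+ _ * C]mulrC mulrA.
apply: is_derive_eq; congr (_ + _).
rewrite (bigD1 j) //= mnmBE mnm1E eqxx subn1 -[LHS]/(c * C * (_ * _ * 1)) mulr1.
rewrite (eq_bigr (fun i => x i ^+ m i)) -/C => [|i ij]; first by ring.
by rewrite mnmBE mnm1E eq_sym (negbTE ij) subn0.
Qed.

Lemma is_derive_quotient (p q : mpoly N R) (x : 'I_N -> R) : meval x q != 0 ->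
  is_derive (x j) (1 : R)
    (fun t => meval (set_coord x j t) p / meval (set_coord x j t) q)
    (meval x (mderiv j p * q - p * mderiv j q) / meval x (q ^+ 2)).
Proof.
move=> qx; have dp := is_derive_meval p x; have dq := is_derive_meval q x.
have qx' : (fun t => meval (set_coord x j t) q) (x j) != 0 by rewrite set_coord_id.
have dV := is_deriveV qx' dq.
apply: is_derive_eq (is_deriveM dp dV) _.
rewrite /= set_coord_id mevalB [q ^+ 2]expr2 !mevalM /GRing.scale /=.
by field.
Qed.

End Derivative.

(** * Strict decrease by the mean value theorem, and the signs of the coefficients *)

Theorem theorem2p14 (R : realType) (N n : nat) (lam rho : 'I_n -> nat)
    (hn : (1 <= n)%N) (hN : (n <= N)%N)
    (hlam : is_partition lam) (hrho : is_partition rho)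
    (hbox : removes_one_box lam rho) :
  (forall (j : 'I_N) (x : 'I_N -> R) (t : R),
      (forall i, 0 < x i) -> x j < t ->
      schur_ratio lam rho (set_coord x j t) < schur_ratio lam rho x)
  /\
  (forall j : 'I_N,
      exists P Q : mpoly N R,
        [/\ Q != 0,
            forall m, 0 <= mcoeff m Q,
            forall m, mcoeff m P <= 0
          & forall x : 'I_N -> R,
              meval x (schur R N rho) != 0 -> meval x Q != 0 ->
              is_derive (x j) (1 : R)
                (fun t : R => schur_ratio lam rho (set_coord x j t))
                (meval x P / meval x Q)]).
Proof.
case: hbox => r0 [lamr0 lam_rho].
case: N hN => [|N' nN]; first by rewrite leqNgt hn.
(* A common bound puts the patterns of both shapes in one type, where their values can be
   swapped. *)
pose M := (\sum_i (lam i + rho i))%N.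
have lamM i : (lam i <= M)%N.
  by rewrite /M (bigD1 i) //= -addnA leq_addr.
have rhoM i : (rho i <= M)%N.
  by rewrite /M (bigD1 i) //= addnAC leq_addl.
have front (j : 'I_N'.+1) := gt_sum_front n M j.
have schur_gt0 (x : 'I_N'.+1 -> R) : (forall i, 0 < x i) ->
    0 < meval x (schur R N'.+1 rho).
  move=> x0; have [s [_ sE]] := front ord0.
  rewrite (schur_gt_poly R hrho rhoM sE).
  exact: meval_gt_poly_gt0 (hook_gt r0 nN hrho rhoM) x0.
split=> [j x t x0 xt|j]; have [s [sj sE]] := front j;
  have lamE := schur_gt_poly R hlam lamM sE;
  have rhoE := schur_gt_poly R hrho rhoM sE.
  pose df c := meval (set_coord x j c) (numerator R M j s lam rho) /
    meval (set_coord x j c) (gt_poly R M s rho ^+ 2).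
  have pos c : x j <= c -> forall i, 0 < set_coord x j c i.
    by move=> xc i; rewrite /set_coord; case: eqP => // _; apply: lt_le_trans xc.
  (* The quotient rule is applied at the point whose coordinate [j] is [c]; there all coordinates
     are positive, so the denominator does not vanish. *)
  have deriv c : x j <= c ->
      is_derive c (1 : R) (fun u => schur_ratio lam rho (set_coord x j u)) (df c).
    move=> xc; have := schur_gt0 _ (pos _ xc); rewrite rhoE => /lt0r_neq0 q0.
    have := is_derive_quotient j (gt_poly R M s lam) q0.
    rewrite {1}/set_coord eqxx /schur_ratio lamE rhoE.
    by under eq_fun => u do rewrite !set_coord_set.
  have [||c cxt] := @MVT R (fun u => schur_ratio lam rho (set_coord x j u)) df (x j) t xt.
  - by move=> c; rewrite in_itv /= => /andP[/ltW xc _]; apply: deriv.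
  - apply: derivable_within_continuous => c; rewrite in_itv /= => /andP[xc _].
    by have [] := deriv c xc.
  rewrite set_coord_id -subr_lt0 => ->.
  have /andP[/ltW xc _] : (x j < c) && (c < t) by move: cxt; rewrite in_itv.
  rewrite nmulr_rlt0 ?subr_gt0 // /df pmulr_llt0.
    by apply: (meval_numerator_lt0 sj lamr0 lam_rho) => //; apply: pos.
  by rewrite invr_gt0 expr2 mevalM -rhoE mulr_gt0 ?schur_gt0 //; apply: pos.
exists (numerator R M j s lam rho), (gt_poly R M s rho ^+ 2); split.
(* The square is nonzero because [s_rho] is positive at the all-ones point. *)
- apply/eqP => q0; have := schur_gt0 (fun=> 1) (fun=> ltr01).
  have := congr1 (meval (fun=> 1)) q0; rewrite expr2 mevalM meval0 -rhoE => /eqP.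
  by rewrite mulf_eq0 orbb => /eqP ->; rewrite ltxx.
- exact: mcoeff_gt_poly_sqr.
- exact: (mcoeff_numerator_le0 R M sj lamr0 lam_rho).
- move=> x q0 _; rewrite /schur_ratio lamE rhoE in q0 *.
  exact: is_derive_quotient.
Qed.
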